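(* For any planar non-collinear four-body central configuration the restricted Hessian $H_{\mathcal C}=\widetilde L+L^\Delta$ (a real symmetric $6\times6$ matrix) has at most two negative eigenvalues, counted with multiplicity.
   Context: Four bodies have masses $m_1,\dots,m_4>0$, $M=\sum_i m_i$, pairwise distinct positions $\mathbf r_i\in\mathbb R^2$ with $\sum_i m_i\mathbf r_i=0$; $\mathbf q_{ij}=\mathbf r_i-\mathbf r_j$, $q_{ij}=|\mathbf q_{ij}|$, $\hat{\mathbf q}_{ij}=\mathbf q_{ij}/q_{ij}$, $\mu_{ij}=m_im_j/M$. The configuration is central if there is $\omega^2>0$ with $\omega^2m_i\mathbf r_i=\sum_{j\ne i}\frac{m_im_j}{q_{ij}^3}\mathbf q_{ij}$ for all $i$ (such $\omega^2$ is then uniquely determined). It is non-collinear if the four positions do not lie on one line. Put $\alpha_{ij}^\perp=\alpha_{ji}^\perp=\mu_{ij}(\omega^2-M/q_{ij}^3)$, $\delta_{ij}=3M\mu_{ij}/q_{ij}^3$, $\mathbf D_{ij}=\mathbf D_{ji}=\delta_{ij}\hat{\mathbf q}_{ij}\hat{\mathbf q}_{ij}^T$. With indices $a,b\in\{2,3,4\}$ and sums over $k\in\{1,2,3,4\}$, $k\ne a$: the reduced transverse Laplacian $\ell\in\mathbb R^{3\times3}$ is $\ell_{a-1,a-1}=\sum_{k\ne a}\alpha_{ak}^\perp$, $\ell_{a-1,b-1}=-\alpha_{ab}^\perp$ $(a\ne b)$; the transverse Laplacian is $\widetilde L=\ell\otimes\mathbf I_2\in\mathbb R^{6\times6}$;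 the gap Laplacian $L^\Delta\in\mathbb R^{6\times6}$ is the $3\times3$ array of $2\times2$ blocks $(L^\Delta)_{a-1,a-1}=\sum_{k\ne a}\mathbf D_{ak}$, $(L^\Delta)_{a-1,b-1}=-\mathbf D_{ab}$ $(a\neq b)$. The restricted Hessian $H_{\mathcal C}=L^\Delta+\widetilde L$ is the Hessian of $\sum_{i<j}\bigl(\frac{M\mu_{ij}}{q_{ij}}+\frac{\omega^2}{2}\mu_{ij}q_{ij}^2\bigr)$ as a function of the independent pair vectors $(\mathbf q_{12},\mathbf q_{13},\mathbf q_{14})\in\mathbb R^6$, where $\mathbf q_{ij}=\mathbf q_{1j}-\mathbf q_{1i}$ for $2\le i<j\le4$. *)

(* Defs.v *)
From mathcomp Require Import all_boot all_order all_algebra.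
From mathcomp Require Import polyrcf mxtens reals.

Set Implicit Arguments.
Unset Strict Implicit.
Unset Printing Implicit Defensive.

Import Order.TTheory GRing.Theory Num.Theory.
Local Open Scope ring_scope.

(* Body number n of the mathematical text (n = 1, .., 4) is the ordinal n - 1. *)

Section FourBody.
Variable R : realType.
Implicit Types (m : 'I_4 -> R) (r : 'I_4 -> 'cV[R]_2) (wsq : R).

Definition norm2 (v : 'cV[R]_2) : R := Num.sqrt (\sum_i v i 0 ^+ 2).

Definition total_mass m : R := \sum_i m i.

Definition qvec r (i j : 'I_4) : 'cV[R]_2 := r i - r j.

Definition qdist r i j : R := norm2 (qvec r i j).

Definition qhat r i j : 'cV[R]_2 := (qdist r i j)^-1 *: qvec r i j.

Definition mu m i j : R := m i * m j / total_mass m.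

(* wsq stands for the multiplier omega^2; it is determined by m and r. *)
Definition central_with m r wsq : Prop :=
  0 < wsq /\
  forall i, (wsq * m i) *: r i =
            \sum_(j | j != i) (m i * m j / qdist r i j ^+ 3) *: qvec r i j.

Definition collinear r : Prop :=
  exists p v : 'cV[R]_2, v != 0 /\ forall i, exists t : R, r i = p + t *: v.

Definition alpha_perp m r wsq i j : R :=
  mu m i j * (wsq - total_mass m / qdist r i j ^+ 3).

Definition delta m r i j : R :=
  3 * total_mass m * mu m i j / qdist r i j ^+ 3.

Definition Dmx m r i j : 'M[R]_2 :=
  delta m r i j *: (qhat r i j *m (qhat r i j)^T).

(* Block row/column a : 'I_3 belongs to the body lift ord0 a, i.e. to one of
   the bodies 2, 3, 4; sums over k still range over all four bodies. *)
Definition reduced_transverse_laplacian m r wsq : 'M[R]_3 :=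
  \matrix_(a, b)
    if a == b
    then \sum_(k | k != lift ord0 a) alpha_perp m r wsq (lift ord0 a) k
    else - alpha_perp m r wsq (lift ord0 a) (lift ord0 b).

Definition transverse_laplacian m r wsq : 'M[R]_(3 * 2) :=
  reduced_transverse_laplacian m r wsq *t (1%:M : 'M[R]_2).

Definition gap_block m r (a b : 'I_3) : 'M[R]_2 :=
  if a == b
  then \sum_(k | k != lift ord0 a) Dmx m r (lift ord0 a) k
  else - Dmx m r (lift ord0 a) (lift ord0 b).

(* mxtens_unindex sends a scalar index to (block index, index in the block),
   the ordering that tensmx uses. *)
Definition gap_laplacian m r : 'M[R]_(3 * 2) :=
  \matrix_(s, t)
    gap_block m r (mxtens_unindex s).1 (mxtens_unindex t).1
                  (mxtens_unindex s).2 (mxtens_unindex t).2.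

Definition restricted_hessian m r wsq : 'M[R]_(3 * 2) :=
  transverse_laplacian m r wsq + gap_laplacian m r.

(* Algebraic multiplicities; rootsR lists the distinct real roots. *)
Definition num_neg_eigenvalues n (A : 'M[R]_n) : nat :=
  (\sum_(x <- rootsR (char_poly A) | (x < 0)%R) mup x (char_poly A))%N.

End FourBody.

(* Main.v *)
(* For a central configuration the weights alpha_perp form a self-stress, so
   [reduced_transverse_laplacian] kills the two coordinate columns of the
   relative positions r_a - r_1.  Non-collinearity makes these independent;
   after tensoring with the identity of R^2 they span a 4-dimensional subspace
   of R^6 on which the restricted Hessian coincides with the positive
   semidefinite gap Laplacian.  A 6 x 6 symmetric matrix that is nonnegative on
   a 4-dimensional subspace has at most two negative eigenvalues. *)
Require Import Defs.
From mathcomp Require Import all_boot all_order all_algebra.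
From mathcomp Require Import polyrcf mxtens complex reals ring.

Set Implicit Arguments.
Unset Strict Implicit.
Unset Printing Implicit Defensive.

Import Order.TTheory GRing.Theory Num.Theory.
Local Open Scope ring_scope.
Local Open Scope sesquilinear_scope.

(** * Negative eigenvalues of a real symmetric matrix and subspaces where its form is nonnegative *)

Lemma char_poly_conj (F : fieldType) (n : nat) (P A : 'M[F]_n) :
  P \in unitmx -> char_poly (invmx P *m A *m P) = char_poly A.
Proof.
move=> Pu; pose Q := map_mx polyC P; pose Qi := map_mx polyC (invmx P).
have QiQ : Qi *m Q = 1%:M by rewrite -map_mxM mulVmx// map_mx1.
have E : char_poly_mx (invmx P *m A *m P) = Qi *m char_poly_mx A *m Q.
  rewrite /char_poly_mx mulmxBr mulmxBl !map_mxM; congr (_ - _).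
  by rewrite scalar_mxC -mulmxA QiQ mulmx1.
by rewrite /char_poly E !det_mulmx mulrC mulrA -det_mulmx (mulmx1C QiQ) det1
           mul1r.
Qed.

(** Used with [s] the roots of a split polynomial listed with repetition and [r] its distinct roots:
    without duplicates in [r], no entry of [s] is counted twice. *)
Lemma sum_count_mem_uniq (T : eqType) (p : pred T) (r s : seq T) :
  uniq r -> (\sum_(x <- r | p x) count_mem x s <= count p s)%N.
Proof.
move=> r_uniq; elim: s => [|y s IHs]; first by rewrite big1.
rewrite big_split/= leq_add//.
case: (boolP (y \in r)) => yr; last first.
  rewrite big_seq_cond big1// => x /andP[xr _].
  by case: eqP => // yx; rewrite yx xr in yr.
rewrite big_mkcond (bigD1_seq y)//= eqxx big1 ?addn0; first by case: (p y).
by move=> x xy; rewrite eq_sym (negPf xy); case: (p x).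
Qed.

Lemma num_neg_eigenvalues_prod (R : realType) (n : nat) (A : 'M[R]_n)
    (e : 'I_n -> R) :
  char_poly A = \prod_i ('X - (e i)%:P) ->
  (num_neg_eigenvalues A <= #|[set i | (e i < 0)%R]|)%N.
Proof.
move=> Ae; rewrite /num_neg_eigenvalues.
have -> : char_poly A = \prod_(y <- [seq e i | i <- enum 'I_n]) ('X - y%:P).
  by rewrite Ae big_map big_enum.
set p := \prod_(_ <- _) _.
under eq_bigr do rewrite mu_prod_XsubC.
apply: leq_trans
  (sum_count_mem_uniq (fun x => (x < 0)%R) _ (uniq_roots _ _ _)) _.
by rewrite -sum1_count big_map big_enum_cond -sum1_card; apply: eq_leq;
   apply: eq_bigl => i; rewrite inE.
Qed.

Lemma trmx_id11 (T : Type) (A : 'M[T]_1) : A^T = A.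
Proof. by apply/matrixP => i j; rewrite mxE !ord1. Qed.

(** Passage from real to complex vectors. For [v = x + iy], both [x] and [y] lie in the row space of
    [K] because [K] is real, and by symmetry of [A] the cross terms cancel, leaving the sum of the
    real forms at [x] and [y]. *)
Lemma hermitian_form_ge0 (R : rcfType) (k n : nat) (A : 'M[R]_n)
    (K : 'M[R]_(k, n)) :
    A^T = A ->
    (forall v : 'rV_n, (v <= K)%MS -> 0 <= (v *m A *m v^T) 0 0) ->
  forall v : 'rV[R[i]]_n, (v <= map_mx (real_complex R) K)%MS ->
    0 <= (v *m map_mx (real_complex R) A *m v^t*) 0 0.
Proof.
move=> Asym Age0 v.
set iota := real_complex R.
have ReImE p (z : 'rV[R[i]]_p) :
    z = map_mx iota (map_mx (@complex.Re R) z) +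
        'i%C *: map_mx iota (map_mx (@complex.Im R) z).
  by apply/rowP => j; rewrite !mxE -complexE.
case/submxP => u vE.
set x := map_mx (@complex.Re R) v; set y := map_mx (@complex.Im R) v.
have xK : (x <= K)%MS.
  apply/submxP; exists (map_mx (@complex.Re R) u); apply/rowP => j.
  rewrite !mxE vE !mxE.
  rewrite raddf_sum; apply: eq_bigr => i _; rewrite !mxE /=.
  by case: (u 0 i) => a b; rewrite /= mulr0 subr0.
have yK : (y <= K)%MS.
  apply/submxP; exists (map_mx (@complex.Im R) u); apply/rowP => j.
  rewrite !mxE vE !mxE.
  rewrite raddf_sum; apply: eq_bigr => i _; rewrite !mxE /=.
  by case: (u 0 i) => a b; rewrite /= mulr0 add0r.
have vcE : v^t* = map_mx iota x^T - 'i%C *: map_mx iota y^T.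
  apply/colP => j; rewrite !mxE; case: (v 0 j) => a b.
  change (Num.conj (Complex a b)) with (Complex a (- b)).
  by rewrite /= /iota; simpc.
have cross : y *m A *m x^T = x *m A *m y^T.
  by rewrite -[LHS]trmx_id11 !trmx_mul trmxK Asym mulmxA.
suff -> : v *m map_mx iota A *m v^t* =
    map_mx iota (x *m A *m x^T + y *m A *m y^T).
  by rewrite 2!mxE ler0c addr_ge0 ?Age0.
rewrite vcE {1}(ReImE _ v) -/x -/y !mulmxDl !mulmxBr -!scalemxAl -!scalemxAr.
rewrite scalerA -expr2 sqr_i -!map_mxM cross map_mxD scaleN1r opprK.
by rewrite addrA addrNK.
Qed.

(** On the span of the eigenvectors with negative eigenvalue the form is negative definite, so this
    span meets the row space of [K] only in 0 and the two dimensions add up to at most [n]. The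
    diagonalization is unitary, over [R[i]]; extending scalars preserves the rank of [K]. *)
Lemma num_neg_eigenvalues_le (R : realType) (k n : nat) (A : 'M[R]_n)
    (K : 'M[R]_(k, n)) :
    A^T = A ->
    (forall v : 'rV_n, (v <= K)%MS -> 0 <= (v *m A *m v^T) 0 0) ->
  (num_neg_eigenvalues A + \rank K <= n)%N.
Proof.
move=> Asym Age0; set iota := real_complex R.
set AC := map_mx iota A; set KC := map_mx iota K.
have iota_real (a : R) : iota a \is Num.real by apply/complex_realP; exists a.
have ACherm : AC \is hermsymmx.
  apply: realsym_hermsym.
    by apply/is_hermitianmxP; rewrite map_mx_id // scale1r map_trmx Asym.
  by apply/mxOverP => i j; rewrite mxE iota_real.
have ACE := orthomx_spectralP (hermitian_normalmx ACherm).
set P := spectralmx AC in ACE; set D := spectral_diag AC in ACE.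
pose e i := complex.Re (D 0 i).
have De i : D 0 i = iota (e i).
  by rewrite [RHS]RRe_real // (mxOverP (hermitian_spectral_diag_real ACherm)).
have Puni : P \is unitarymx := spectral_unitarymx AC.
have char_A : char_poly A = \prod_i ('X - (e i)%:P).
  apply: (map_inj_poly (@complexI R)) => //.
  rewrite -/iota rmorph_prod map_char_poly -/AC ACE.
  rewrite char_poly_conj ?spectral_unit//.
  rewrite char_poly_trig ?diag_mx_is_trig//; apply: eq_bigr => i _.
  by rewrite mxE eqxx mulr1n De /= map_polyXsubC.
apply: leq_trans (leq_add (num_neg_eigenvalues_prod char_A) (leqnn _)) _.
set J := [set i | _].
pose f (j : 'I_#|J|) : 'I_n := enum_val j.
pose N := rowsub f P.
have NN : N *m N^t* = 1%:M.
  apply/matrixP => i j.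
  have /unitarymxP/matrixP/(_ (f i) (f j)) := Puni.
  rewrite !mxE (inj_eq enum_val_inj) => <-.
  by apply: eq_bigr => l _; rewrite !mxE.
have rankN : \rank N = #|J| by rewrite mxrank_unitary//; apply/unitarymxP.
have NAN : N *m AC *m N^t* = diag_mx (\row_j D 0 (f j)).
  have NX (X : 'M_n) : N *m X = rowsub f (P *m X) by rewrite mul_rowsub_mx.
  have -> : N^t* = colsub f (P^t*) by apply/matrixP => i j; rewrite !mxE.
  rewrite NX mulmx_colsub mul_rowsub_mx -(invmx_unitary Puni) {1}ACE.
  rewrite -!mulmxA mulmxV ?spectral_unit// mulmx1 mulKVmx ?spectral_unit//.
  by apply/matrixP => i j; rewrite !mxE (inj_eq enum_val_inj).
(* The rows of N span the negative eigenvectors, so N meets K trivially. *)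
rewrite leqNgt; apply/negP => lt_n.
have /rowV0Pn[v] : (N :&: KC)%MS != 0.
  rewrite -mxrank_eq0 -lt0n -(ltn_add2l (\rank (N + KC)%MS)).
  rewrite mxrank_sum_cap addn0.
  by rewrite rankN mxrank_map (leq_ltn_trans (rank_leq_col _)).
rewrite sub_capmx => /andP[/submxP[w vE] vK] /negP[]; apply/eqP.
have := hermitian_form_ge0 Asym Age0 vK.
have -> : v *m AC *m v^t* = w *m diag_mx (\row_j D 0 (f j)) *m w^t*.
  by rewrite -NAN vE trmx_mul map_mxM !mulmxA.
have wE : (w *m diag_mx (\row_j D 0 (f j)) *m w^t*) 0 0 =
    - \sum_j iota (- e (f j)) * `|w 0 j| ^+ 2.
  rewrite mxE -sumrN; apply: eq_bigr => j _.
  by rewrite mul_mx_diag !mxE De normCK /iota rmorphN mulNr opprK mulrCA mulrA.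
have e_lt0 j : e (f j) < 0 by have := enum_valP j; rewrite inE.
(* The form is nonnegative at [v] as a vector of [K], yet is minus a sum of nonnegative terms: every
   term vanishes, and [e (f j) < 0] forces [w = 0]. *)
rewrite wE oppr_ge0 => sum_le0.
have term_ge0 j : true -> 0 <= iota (- e (f j)) * `|w 0 j| ^+ 2.
  by move=> _; rewrite mulr_ge0 ?exprn_ge0// ler0c oppr_ge0 ltW.
have /(psumr_eq0P term_ge0) w0 : \sum_j iota (- e (f j)) * `|w 0 j| ^+ 2 = 0.
  by apply/le_anti; rewrite sum_le0 sumr_ge0.
rewrite vE (_ : w = 0) ?mul0mx//; apply/rowP => j; rewrite mxE.
have /eqP := w0 j isT; rewrite mulf_eq0 expf_eq0/= normr_eq0.
case/orP => [/eqP [] /eqP | /eqP //].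
by rewrite oppr_eq0 (lt_eqF (e_lt0 j)).
Qed.

(** * Block Laplacians and their quadratic forms *)

(* Deleting row and column 0 of the full Laplacian loses nothing on
   configurations with [y ord0 = 0]. *)
Lemma reduced_laplacian_action (V U : zmodType) (n : nat) (a : 'I_n)
    (f : 'I_n.+1 -> {additive V -> U}) (y : 'I_n.+1 -> V) :
  y ord0 = 0 ->
  \sum_b (if a == b then \sum_(k | k != lift ord0 a) f k (y (lift ord0 a))
          else - f (lift ord0 b) (y (lift ord0 b)))
  = \sum_k f k (y (lift ord0 a) - y k).
Proof.
move=> y0; rewrite (bigD1 a)//= eqxx [RHS](bigD1 (lift ord0 a))//=.
rewrite subrr raddf0 add0r; under [RHS]eq_bigr do rewrite raddfB.
rewrite big_split/=; congr (_ + _).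
rewrite big_mkcond [RHS]big_mkcond [RHS]big_ord_recl/= y0 raddf0 oppr0 ?if_same.
rewrite add0r; apply: eq_bigr => b _; rewrite (inj_eq lift_inj).
by case: eqVneq => //= ba; rewrite eq_sym (negPf ba).
Qed.

(** Symmetrization: add the sum to its copy with [i] and [k] exchanged. *)
Lemma laplacian_energy (R : comNzRingType) (n d : nat)
    (W : 'I_n -> 'I_n -> 'M[R]_d) (y : 'I_n -> 'cV[R]_d) :
  (forall i j, W i j = W j i) ->
  (\sum_i \sum_k (y i)^T *m W i k *m (y i - y k)) *+ 2
  = \sum_i \sum_k (y i - y k)^T *m W i k *m (y i - y k).
Proof.
move=> Wsym; rewrite mulr2n {2}exchange_big -big_split/=; apply: eq_bigr => i _.
rewrite -big_split/=; apply: eq_bigr => k _.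
by rewrite (Wsym k i) -[y k - y i]opprB mulmxN -mulNmx -mulmxDl -mulNmx -mulmxDl
           -raddfB.
Qed.

Lemma sum_mxtens_index (V : nmodType) (m n : nat) (F : 'I_(m * n) -> V) :
  \sum_s F s = \sum_a \sum_k F (mxtens_index (a, k)).
Proof.
rewrite pair_bigA/= (reindex (@mxtens_index m n)); last first.
  by exists (@mxtens_unindex m n) => x _;
     rewrite (mxtens_indexK, mxtens_unindexK).
by apply: eq_bigr => -[].
Qed.

Lemma tensmx11 (R : pzRingType) (m n : nat) :
  (1%:M : 'M[R]_m) *t (1%:M : 'M[R]_n) = 1%:M.
Proof.
apply/matrixP => s t; case: (mxtens_indexP s) => a k.
case: (mxtens_indexP t) => b l.
by rewrite tensmxE !mxE (can_eq (@mxtens_indexK _ _)) xpair_eqE -natrM mulnb.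
Qed.

Definition vec_block (R : Type) (m n : nat) (v : 'rV[R]_(m * n)) (a : 'I_m) :
  'cV[R]_n := \col_k v 0 (mxtens_index (a, k)).

Lemma block_form (R : comNzRingType) (m n : nat) (B : 'I_m -> 'I_m -> 'M[R]_n)
    (v : 'rV[R]_(m * n)) :
  v *m (\matrix_(s, t) B (mxtens_unindex s).1 (mxtens_unindex t).1
                         (mxtens_unindex s).2 (mxtens_unindex t).2) *m v^T
  = \sum_a \sum_b (vec_block v a)^T *m B a b *m vec_block v b.
Proof.
apply/matrixP => i j; rewrite !ord1 mxE summxE sum_mxtens_index.
under [RHS]eq_bigr do rewrite summxE.
rewrite [RHS]exchange_big; apply: eq_bigr => b _.
under [RHS]eq_bigr do rewrite mxE.
rewrite [RHS]exchange_big; apply: eq_bigr => l _.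
rewrite !mxE sum_mxtens_index mulr_suml; apply: eq_bigr => a _.
rewrite !mxE; congr (_ * _); apply: eq_bigr => k _.
by rewrite !mxE !mxtens_indexK.
Qed.

(** * The two Laplacians of a four-body configuration *)

Section FourBody.
Variable R : realType.
Implicit Types (m : 'I_4 -> R) (r : 'I_4 -> 'cV[R]_2) (wsq : R).

Lemma qdistC r i j : qdist r i j = qdist r j i.
Proof.
rewrite /qdist /norm2 /qvec -opprB; congr (Num.sqrt _).
by apply: eq_bigr => k _; rewrite mxE sqrrN.
Qed.

Lemma muC m i j : mu m i j = mu m j i.
Proof. by rewrite /mu (mulrC (m i)). Qed.

Lemma alpha_perpC m r wsq i j : alpha_perp m r wsq i j = alpha_perp m r wsq j i.
Proof. by rewrite /alpha_perp qdistC muC. Qed.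

Lemma DmxC m r i j : Dmx m r i j = Dmx m r j i.
Proof.
rewrite /Dmx /delta /qhat qdistC muC /qvec -[r i - r j]opprB scalerN.
by rewrite linearN mulNmx mulmxN opprK.
Qed.

Lemma Dmx_sym m r i j : (Dmx m r i j)^T = Dmx m r i j.
Proof. by rewrite /Dmx linearZ/= trmx_mul trmxK. Qed.

(** The form is a nonnegative weight times the square of the inner product of [z] with
    [qhat r i j]. *)
Lemma Dmx_ge0 m r i j (z : 'cV_2) :
  (forall i, 0 < m i) -> 0 <= (z^T *m Dmx m r i j *m z) 0 0.
Proof.
move=> m_gt0; have M_ge0 : 0 <= total_mass m.
  by apply: sumr_ge0 => k _; apply: ltW.
rewrite /Dmx -scalemxAr -scalemxAl mxE mulr_ge0//.
  rewrite /delta /mu divr_ge0 ?exprn_ge0 ?sqrtr_ge0//.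
  by rewrite !mulr_ge0 ?invr_ge0 ?ler0n ?(ltW (m_gt0 _)).
rewrite (mulmxA z^T) -mulmxA -[z^T *m _]trmx_id11 trmx_mul trmxK mxE big_ord1.
by rewrite -expr2 sqr_ge0.
Qed.

Lemma reduced_transverse_laplacian_sym m r wsq :
  (reduced_transverse_laplacian m r wsq)^T =
  reduced_transverse_laplacian m r wsq.
Proof.
apply/matrixP => a b; rewrite !mxE [b == a]eq_sym.
by case: eqVneq => [->//|_]; rewrite alpha_perpC.
Qed.

Lemma restricted_hessian_sym m r wsq :
  (restricted_hessian m r wsq)^T = restricted_hessian m r wsq.
Proof.
rewrite linearD/= trmx_tens trmx1 reduced_transverse_laplacian_sym.
congr (_ *t _ + _).
apply/matrixP => s t; rewrite !mxE /gap_block.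
rewrite [_.1 == (mxtens_unindex s).1]eq_sym.
case: eqVneq => [->|_].
  by rewrite !summxE; apply: eq_bigr => k _; rewrite -[in LHS]Dmx_sym mxE.
by rewrite DmxC -[in LHS]Dmx_sym !mxE.
Qed.

Lemma gap_laplacian_ge0 m r (v : 'rV_(3 * 2)) :
  (forall i, 0 < m i) -> 0 <= (v *m gap_laplacian m r *m v^T) 0 0.
Proof.
move=> m_gt0; rewrite block_form.
(* Body 1 gets displacement 0, which turns the reduced form into the full Laplacian form on four
   bodies. *)
pose y (i : 'I_4) := if unlift ord0 i is Some a then vec_block v a else 0.
have yl a : y (lift ord0 a) = vec_block v a by rewrite /y liftK.
have y0 : y ord0 = 0 by rewrite /y unlift_none.
set S := \sum_a _.
have -> : S = \sum_i \sum_k (y i)^T *m Dmx m r i k *m (y i - y k).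
  rewrite big_ord_recl y0 big1 ?add0r; last first.
    by move=> k _; rewrite trmx0 !mul0mx.
  apply: eq_bigr => a _.
  under [RHS]eq_bigr do rewrite -mulmxA.
  rewrite -mulmx_sumr.
  rewrite -(reduced_laplacian_action a
              (fun k => mulmx (Dmx m r (lift ord0 a) k)) y0).
  rewrite mulmx_sumr; apply: eq_bigr => b _; rewrite -mulmxA yl /gap_block.
  by case: eqVneq => [->|_]; rewrite ?mulmx_suml// mulNmx yl.
rewrite -(pmulrn_lge0 _ (ltn0Sn 1)) -mulmxnE laplacian_energy; last exact: DmxC.
rewrite summxE sumr_ge0// => i _; rewrite summxE sumr_ge0// => k _.
exact: Dmx_ge0.
Qed.

(** The self-stress identity: by the barycenter condition the [wsq] part sums to
    [(wsq * m i) *: r i], and the remaining part is the attraction that the central equation equates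
    with it. *)
Lemma alpha_perp_balance m r wsq i :
    (forall i, 0 < m i) -> \sum_i m i *: r i = 0 -> central_with m r wsq ->
  \sum_k alpha_perp m r wsq i k *: (r i - r k) = 0.
Proof.
move=> m_gt0 bary [_ /(_ i) central].
have M_neq0 : total_mass m != 0.
  rewrite gt_eqF// /total_mass big_ord_recl ltr_pwDl//.
  by rewrite sumr_ge0// => k _; apply: ltW.
have mass_sum : \sum_k m k *: (r i - r k) = total_mass m *: r i.
  under eq_bigr do rewrite scalerBr.
  by rewrite sumrB bary subr0 -scaler_suml.
have alphaE k : alpha_perp m r wsq i k =
    wsq * m i / total_mass m * m k - m i * m k / qdist r i k ^+ 3.
  rewrite /alpha_perp /mu mulrBr; congr (_ - _); last by rewrite mulrA mulfVK.
  by rewrite mulrC mulrAC !mulrA.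
under eq_bigr do rewrite alphaE scalerBl -[in X in X - _]scalerA.
rewrite sumrB -scaler_sumr mass_sum scalerA mulfVK// central.
rewrite [X in _ - X](bigD1 i)//= subrr scaler0 add0r.
by apply/eqP; rewrite subr_eq0.
Qed.

Definition relative_positions r : 'M[R]_(3, 2) :=
  \matrix_(a, j) (r (lift ord0 a) - r ord0) j 0.

Lemma reduced_transverse_laplacian_kernel m r wsq :
    (forall i, 0 < m i) -> \sum_i m i *: r i = 0 -> central_with m r wsq ->
  reduced_transverse_laplacian m r wsq *m relative_positions r = 0.
Proof.
move=> m_gt0 bary central; apply/matrixP => a j; rewrite !mxE.
pose y k := r k - r ord0.
have y0 : y ord0 = 0 by rewrite /y subrr.
pose f k : {additive 'cV[R]_2 -> 'cV[R]_2} :=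
  *:%R (alpha_perp m r wsq (lift ord0 a) k).
have := reduced_laplacian_action a f y0.
under [in RHS]eq_bigr do rewrite /= /y opprB addrA subrK.
rewrite alpha_perp_balance// => /colP/(_ j); rewrite summxE mxE => balance.
rewrite -[RHS]balance.
apply: eq_bigr => b _; rewrite !mxE; case: eqVneq => [<-|_].
  by rewrite /= -scaler_suml !mxE.
by rewrite !mxE mulNr.
Qed.

(** A nonzero [w] orthogonal to all relative positions would place every body on the line through
    [r ord0] perpendicular to [w]. *)
Lemma relative_positions_rank r :
  ~ collinear r -> row_free (relative_positions r)^T.
Proof.
move=> ncoll; rewrite -kermx_eq0; apply: contra_notT ncoll.
case/rowV0Pn => w /sub_kermxP wB w_neq0.
have ord2E (j : 'I_2) : j = 0 \/ j = 1.
  by case: j => [[|[|//]] lt_j]; [left|right]; apply/val_inj.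
have N_neq0 : w 0 0 ^+ 2 + w 0 1 ^+ 2 != 0.
  apply: contra_neq w_neq0 => /eqP.
  rewrite paddr_eq0 ?sqr_ge0// !sqrf_eq0 => /andP[/eqP w0 /eqP w1].
  by apply/rowP => j; rewrite mxE; case: (ord2E j) => ->.
(* The direction is [w] turned by a right angle. *)
exists (r ord0), (\col_j (if j == 0 then - w 0 1 else w 0 0)); split.
  apply: contra_neq N_neq0 => /colP v0; move: (v0 0) (v0 1); rewrite !mxE /=.
  by move=> /eqP; rewrite oppr_eq0 => /eqP -> ->; rewrite expr0n addr0.
move=> i; case: (unliftP ord0 i) => [a ->|->]; last first.
  by exists 0; rewrite scale0r addr0.
set d := r (lift ord0 a) - r ord0.
have dw : w 0 0 * d 0 0 + w 0 1 * d 1 0 = 0.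
  move/rowP/(_ a): wB; rewrite mxE big_ord_recl big_ord1 !mxE => wB.
  by rewrite (_ : (1 : 'I_2) = lift ord0 ord0)//; apply/val_inj.
(* Coefficient of the orthogonal projection of [d] onto that direction. The error in coordinate [j]
   is then, up to the nonzero denominator, [w 0 j] times the left side of [dw]. *)
exists ((d 1 0 * w 0 0 - d 0 0 * w 0 1) / (w 0 0 ^+ 2 + w 0 1 ^+ 2)).
apply/eqP; rewrite addrC -subr_eq -/d; apply/eqP; move: d dw => d dw.
apply/colP => j; rewrite !mxE; apply: (mulIf N_neq0).
rewrite mulrAC mulfVK//; apply/eqP; rewrite -subr_eq0; apply/eqP.
case: (ord2E j) => ->/=.
  by rewrite -(mulr0 (w 0 0)) -dw; ring.
by rewrite -(mulr0 (w 0 1)) -dw; ring.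
Qed.

Lemma restricted_hessian_ge0 m r wsq (v : 'rV_(3 * 2)) :
    (forall i, 0 < m i) -> \sum_i m i *: r i = 0 -> central_with m r wsq ->
    (v <= (relative_positions r)^T *t (1%:M : 'M[R]_2))%MS ->
  0 <= (v *m restricted_hessian m r wsq *m v^T) 0 0.
Proof.
move=> m_gt0 bary central /submxP[u vE].
rewrite mulmxDr mulmxDl mxE addr_ge0 ?gap_laplacian_ge0//.
(* Only the left copy of [v] is expanded: the factor applied to the transverse Laplacian is the
   transpose of the reduced Laplacian times the relative positions, hence 0. *)
rewrite /transverse_laplacian {1}vE -(mulmxA u) tensmx_mul.
rewrite -reduced_transverse_laplacian_sym -trmx_mul.
rewrite reduced_transverse_laplacian_kernel//.
by rewrite trmx0 tens0mx mulmx0 mul0mx mxE.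
Qed.

End FourBody.

Theorem proposition5p7 (R : realType) (m : 'I_4 -> R) (r : 'I_4 -> 'cV[R]_2)
    (wsq : R)
    (m_gt0 : forall i, 0 < m i)
    (r_inj : injective r)
    (barycenter0 : \sum_i m i *: r i = 0)
    (r_central : central_with m r wsq)
    (r_noncollinear : ~ collinear r) :
  (restricted_hessian m r wsq)^T = restricted_hessian m r wsq /\
  (num_neg_eigenvalues (restricted_hessian m r wsq) <= 2)%N.
Proof.
have H_sym := restricted_hessian_sym m r wsq; split=> //.
pose K := (relative_positions r)^T *t (1%:M : 'M[R]_2).
have /eqP rankK : row_free K.
  have /row_freeP[C BC] := relative_positions_rank r_noncollinear.
  apply/row_freeP; exists (C *t (1%:M : 'M[R]_2)).
  by rewrite tensmx_mul BC mulmx1 tensmx11.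
have := num_neg_eigenvalues_le H_sym
  (fun v => restricted_hessian_ge0 m_gt0 barycenter0 r_central).
(* The rank of [K] is [2 * 2], and 6 - 4 = 2. *)
by rewrite rankK -[(3 * 2)%N]/(2 + 2 * 2)%N leq_add2r.
Qed.
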